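(* Suppose that $\mathbb{P}_{\theta^c}$ has a known, finite support $\{r_1,\dots,r_n\}\subset\mathbb{R}^d$. Then the following uncertainty set $\Xi(\mathcal{S}^N,\epsilon,\alpha)$ satisfies (i.e. implies) the Bayesian distributionally robust chance constraint for all $0<\epsilon<1$: $$\Xi(\mathcal{S}^N,\epsilon,\alpha)=\left\{\xi\in\mathbb{R}^d:\ \xi=\sum_{j=1}^n q_jr_j,\ q\in\Delta_n,\ q\leq\tfrac{1}{\epsilon}\theta,\ \theta\in\Theta(\mathcal{S}^N,\alpha)\right\}.$$ That is, for every $x\in\mathbb{R}^k$, if $g(\xi,x)\leq 0$ for all $\xi\in\Xi(\mathcal{S}^N,\epsilon,\alpha)$, then $$\inf_{\theta\in\Theta(\mathcal{S}^N,\alpha)}\mathbb{P}_{\theta}\big(g(\tilde{\xi},x)\leq 0\big)\geq 1-\epsilon.$$ The corresponding support function is given, for $v\in\mathbb{R}^d$, by $$\delta^*(v|\Xi(\mathcal{S}^N,\epsilon,\alpha))=\min_{\beta,w,\eta,\lambda}\ \beta+\frac{1}{\epsilon}\left(\hat{\theta}^Tw+\mathbf{d}^T\eta+z_{1-\frac{\alpha}{2}}^2\lambda-\sum_{j=1}^n\frac{(b_j^Tw-c_j^T\eta)^2}{4\lambda}\right)$$ $$\text{s.t. } w,\lambda,\eta\geq 0,\quad r_j^Tv-w_j\leq\beta,\ j=1,\dots,n,$$ where $B=[I(\hat\theta)]^{-1/2}$ has columns $b_1,\dots,b_n$; $C$ is the $(n+2)\times n$ matrix obtained by stacking the row $e^T[I(\hat\theta)]^{-1/2}$,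 the row $-e^T[I(\hat\theta)]^{-1/2}$ and the block $-[I(\hat\theta)]^{-1/2}$, with columns $c_1,\dots,c_n$; and $\mathbf{d}=(1-e^T\hat\theta,\ -1+e^T\hat\theta,\ -\hat\theta)\in\mathbb{R}^{n+2}$ (a column vector). Here $\beta,\lambda\in\mathbb{R}$, $w\in\mathbb{R}^n$, $\eta\in\mathbb{R}^{n+2}$.
   Context: $e$ is the all-ones vector, $\Delta_n=\{\theta\in\mathbb{R}^n_+:e^T\theta=1\}$ is the probability simplex, and inequalities between vectors are componentwise. The credible level is $\alpha\in[0,1)$. The distributions $\mathbb{P}_\theta$ of the random vector $\tilde\xi$ are those supported on $\{r_1,\dots,r_n\}$ with $\mathbb{P}_\theta(\tilde\xi=r_j)=\theta_j$, $\theta\in\Delta_n$; the true (unknown) parameter is $\theta^c$. The constraint function $g:\mathbb{R}^d\times\mathbb{R}^k\to\mathbb{R}$ is concave and finite-valued in its first argument for every $x\in\mathbb{R}^k$. The data $\mathcal{S}^N=\{\xi^1,\dots,\xi^N\}$ are drawn i.i.d. from $\mathbb{P}_{\theta^c}$. Given a prior density $p(\theta)$, the posterior density is $p(\theta|\mathcal{S}^N)\propto p(\theta)\prod_{i=1}^N\mathbb{P}_\theta(\tilde\xi=\xi^i)$; $\hat\theta$ is the posterior mode and $I(\hat\theta)=-\frac{d^2}{d\theta^2}\log p(\theta|\mathcal{S}^N)\big|_{\theta=\hat\theta}$ is the observed information matrix, assumed positive definite. The Bayesian credible set is $\Theta(\mathcal{S}^N,\alpha)=\{\theta\in\Delta_n:\|[I(\hat\theta)]^{1/2}(\theta-\hat\theta)\|_2\leq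 z_{1-\frac{\alpha}{2}}\}$, where $z_{1-\frac{\alpha}{2}}$ is the $1-\frac{\alpha}{2}$ quantile of the standard normal distribution. The support function of a set $\Xi$ is $\delta^*(v|\Xi)=\sup_{\xi\in\Xi}v^T\xi$.
   Formalization: The printed dual is unbounded below, so two signs are corrected: the last block of d is +θ̂ (not −θ̂), and the term Σ(b_jᵀw−c_jᵀη)²/(4λ) enters with a plus sign; at λ=0 it is read as +∞ if a numerator is nonzero and 0 otherwise. *)

(* Defs.v *)
From HB Require Import structures.
From mathcomp Require Import all_boot all_order all_algebra.
From mathcomp Require Import all_classical all_reals all_analysis.
Set Implicit Arguments.
Unset Strict Implicit.
Unset Printing Implicit Defensive.
Import Order.TTheory GRing.Theory Num.Theory.
Import numFieldNormedType.Exports.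
Local Open Scope classical_set_scope.
Local Open Scope ring_scope.

Definition dotv (R : realType) (n : nat) (u v : 'cV[R]_n) : R :=
  (u^T *m v) 0 0.

(* The library norm on matrices is the sup norm. *)
Definition norm2 (R : realType) (n : nat) (u : 'cV[R]_n) : R :=
  Num.sqrt (dotv u u).

Definition simplex (R : realType) (n : nat) : set 'cV[R]_n :=
  [set t | (forall j, 0 <= t j 0) /\ \sum_j t j 0 = 1].

Definition posdefmx (R : realType) (n : nat) (A : 'M[R]_n) : Prop :=
  A^T = A /\ forall u : 'cV[R]_n, u != 0 -> 0 < dotv u (A *m u).

Definition possemidefmx (R : realType) (n : nat) (A : 'M[R]_n) : Prop :=
  A^T = A /\ forall u : 'cV[R]_n, 0 <= dotv u (A *m u).

(* Principal square root A^{1/2}: the unique positive semidefinite S with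
   S S = A; it exists whenever A is positive semidefinite. *)
Definition sqrtmx (R : realType) (n : nat) (A : 'M[R]_n) : 'M[R]_n :=
  xget 0 [set S | possemidefmx S /\ S *m S = A].

Definition hessian (R : realType) (n : nat) (f : 'cV[R]_n -> R)
    (a : 'cV[R]_n) : 'M[R]_n :=
  \matrix_(i, j) 'D_(delta_mx i 0) ('D_(delta_mx j 0) f) a.

Definition twice_differentiable (R : realType) (n : nat) (f : 'cV[R]_n -> R)
    (a : 'cV[R]_n) : Prop :=
  (\forall x \near a, differentiable f x) /\
  (forall j, differentiable ('D_(delta_mx j 0) f) a).

(* The p-quantile inf {x | F(x) >= p} of the standard normal distribution
   function F; it is extended-real, with value +oo at p = 1. *)
Definition normal_quantile (R : realType) (p : R) : \bar R :=
  ereal_inf [set x%:E | x in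
    [set x : R | (p%:E <= normal_prob (0 : R) 1 `]-oo, x])%E]].

(* P_theta: the law on R^d putting mass theta_j on the atom r_j. *)
Definition discrete_prob (R : realType) (n d : nat) (r : 'I_n -> 'cV[R]_d)
    (theta : 'cV[R]_n) (A : set 'cV[R]_d) : R :=
  \sum_(j < n | r j \in A) theta j 0.

(* The X_i are i.i.d. with the finitely supported law mu: their joint
   probability mass function is the product of the marginal ones. *)
Definition iid_sample (R : realType) (disp : measure_display)
    (Omega : measurableType disp) (P : probability Omega R) (N d : nat)
    (X : 'I_N -> Omega -> 'cV[R]_d) (mu : set 'cV[R]_d -> R) : Prop :=
  forall y : 'I_N -> 'cV[R]_d,
    let E := [set omega | forall i, X i omega = y i] in
    measurable E /\ P E = (\prod_(i < N) mu [set y i])%:E.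

(* Posterior densities are given up to a positive normalising constant, which
   affects neither the mode nor the observed information. *)
Definition posterior_density (R : realType) (n d N : nat)
    (r : 'I_n -> 'cV[R]_d) (prior : 'cV[R]_n -> R) (xi : 'I_N -> 'cV[R]_d)
    (post : 'cV[R]_n -> R) : Prop :=
  exists2 kappa : R, 0 < kappa & forall theta,
    post theta =
    kappa * (prior theta * \prod_(i < N) discrete_prob r theta [set xi i]).

Definition posterior_mode (R : realType) (n : nat) (post : 'cV[R]_n -> R)
    (thetahat : 'cV[R]_n) : Prop :=
  simplex thetahat /\ forall theta, simplex theta -> post theta <= post thetahat.

Definition observed_info (R : realType) (n : nat) (post : 'cV[R]_n -> R)
    (thetahat : 'cV[R]_n) : 'M[R]_n :=
  - hessian (fun theta => ln (post theta)) thetahat.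

Definition credible_set (R : realType) (n : nat) (info : 'M[R]_n)
    (thetahat : 'cV[R]_n) (z : \bar R) : set 'cV[R]_n :=
  [set theta | simplex theta /\
    ((norm2 (sqrtmx info *m (theta - thetahat)))%:E <= z)%E].

Definition uncertainty_set (R : realType) (n d : nat) (r : 'I_n -> 'cV[R]_d)
    (eps : R) (Theta : set 'cV[R]_n) : set 'cV[R]_d :=
  [set xi | exists q theta : 'cV[R]_n,
    [/\ xi = \sum_(j < n) q j 0 *: r j, simplex q, Theta theta &
        forall j, q j 0 <= eps^-1 * theta j 0]].

Definition support_function (R : realType) (d : nat) (Xi : set 'cV[R]_d)
    (v : 'cV[R]_d) : \bar R :=
  ereal_sup [set (dotv v xi)%:E | xi in Xi].

Definition dual_matrix (R : realType) (n : nat) (B : 'M[R]_n) :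
    'M[R]_(1 + 1 + n, n) :=
  col_mx (col_mx (const_mx 1 *m B) (- (const_mx 1 *m B))) (- B).

(* Writing theta = thetahat + B u, membership of theta in the simplex reads
   C u <= dd, with C the matrix above; the last block -B u <= thetahat is
   theta >= 0.  (The source prints -thetahat for the last block of dd.) *)
Definition dual_vector (R : realType) (n : nat) (thetahat : 'cV[R]_n) :
    'cV[R]_(1 + 1 + n) :=
  col_mx (col_mx (const_mx (1 - \sum_j thetahat j 0))
                 (const_mx (- 1 + \sum_j thetahat j 0)))
         thetahat.

Definition dual_feasible (R : realType) (n d : nat) (r : 'I_n -> 'cV[R]_d)
    (v : 'cV[R]_d) (beta : R) (w : 'cV[R]_n) (eta : 'cV[R]_(1 + 1 + n))
    (lambda : R) : Prop :=
  [/\ forall j, 0 <= w j 0, 0 <= lambda, forall i, 0 <= eta i 0 &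
      forall j, dotv (r j) v - w j 0 <= beta].

(* The quadratic term is the supremum over u of
   (B^T w - C^T eta)^T u - lambda |u|^2, hence enters with a plus sign (the
   source prints a minus sign, which makes the infimum -oo).  Extended-real
   division and product give t^2 / 0 = +oo for t != 0, 0 / 0 = 0 and
   (+oo) * 0 = 0, the values this supremum takes at lambda = 0. *)
Definition dual_objective (R : realType) (n : nat) (eps : R) (z : \bar R)
    (thetahat : 'cV[R]_n) (B : 'M[R]_n) (beta : R) (w : 'cV[R]_n)
    (eta : 'cV[R]_(1 + 1 + n)) (lambda : R) : \bar R :=
  let C := dual_matrix B in
  let dd := dual_vector thetahat in
  (beta%:E + (eps^-1)%:E *
    ((dotv thetahat w)%:E + (dotv dd eta)%:E + z ^+ 2 * lambda%:E +
     \sum_(j < n) ((dotv (col j B) w - dotv (col j C) eta) ^+ 2)%R%:E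
                    / (4 * lambda)%R%:E))%E.

(* Main.v *)
Require Import Defs.
From HB Require Import structures.
From mathcomp Require Import all_boot all_order all_algebra.
From mathcomp Require Import complex spectral.
From mathcomp Require Import all_classical all_reals all_analysis.
From mathcomp Require Import measurable_realfun.
From mathcomp Require Import ring lra.
Set Implicit Arguments.
Unset Strict Implicit.
Unset Printing Implicit Defensive.
Import Order.TTheory GRing.Theory Num.Theory.
Import numFieldNormedType.Exports.
Local Open Scope classical_set_scope.
Local Open Scope ring_scope.

(** The chance constraint follows by conditioning on its violation.  If some theta in the credible set gave the unsafe atoms (those with
    0 < g) a mass m > eps, then conditioning theta on them would give weights
    q = theta / m <= theta / eps, so the barycentre of the unsafe atoms for q
    would lie in the uncertainty set; by concavity g is positive there, a
    contradiction ([uncertainty_set_chance]).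

    The support function is the value of maximising sum_j q_j c_j, with
    c_j = r_j . v, over q in the simplex, q <= theta / eps, theta in the
    simplex and |S (theta - thetahat)| <= z, where S is the square root of the
    information matrix.  Weak duality is the usual pairing of the constraints
    with their multipliers; writing theta = thetahat + B u, the ball constraint
    is paid for by the Fenchel inequality
    t . u <= lambda |u|^2 + |t|^2 / (4 lambda) ([weak_duality]).

    For strong duality with attainment two observations avoid any general
    theory of convex programs.

    First, the polyhedral constraints disappear by the substitution
    theta = eps q + (1 - eps) s: the pairs (q, theta) with q <= theta / eps are
    exactly the images of the pairs (q, s) in the product of two simplices.
    The ball is then the only remaining constraint, the point
    q = s = thetahat satisfies it strictly because z > 0, and a one-constraint
    Lagrange argument yields a multiplier l ([lagrange_multiplier]).

    Second, the Lagrangian has a maximiser (q, s) over the compact product of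
    simplices.  Its first-order condition, tested only at pairs of vertices,
    reads c_i - eps a_i - (1 - eps) a_k <= c . q - a . theta, where
    a = 2 l S S (theta - thetahat).  From it an optimal dual point is written
    down explicitly: mu = max_k (- a_k), w = eps (mu + a),
    beta = c . q - a . theta - mu, eta carries eps mu on the two rows encoding
    e . theta = 1 and vanishes on the rows encoding theta >= 0, and
    lambda = eps l ([strong_duality]).

    Two facts feed this argument.  The quantile z is positive since the normal
    law gives mass 1/2 to the negative half-line and has a bounded density
    ([normal_quantile_gt0]); it is +oo for alpha = 0, when the ball is vacuous
    and lambda = 0 is optimal ([strong_duality_no_ball]).  The square root of a
    positive definite matrix exists ([sqrtmx_exists]), by diagonalising over
    the complex numbers. *)

(** * The Euclidean inner product *)

Lemma dotvE (R : realType) n (u v : 'cV[R]_n) :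
  dotv u v = \sum_i u i 0 * v i 0.
Proof. by rewrite /dotv mxE; apply: eq_bigr => i _; rewrite mxE. Qed.

Lemma dotvvE (R : realType) n (u : 'cV[R]_n) : dotv u u = \sum_i u i 0 ^+ 2.
Proof. by rewrite dotvE; apply: eq_bigr => i _; rewrite expr2. Qed.

Lemma dotvv_ge0 (R : realType) n (u : 'cV[R]_n) : 0 <= dotv u u.
Proof. by rewrite dotvE sumr_ge0// => i _; rewrite -expr2 sqr_ge0. Qed.

Lemma dotvv_gt0 (R : realType) n (u : 'cV[R]_n) : u != 0 -> 0 < dotv u u.
Proof.
move=> u0; rewrite lt_neqAle dotvv_ge0 andbT eq_sym; apply: contra u0.
rewrite dotvE psumr_eq0; last by move=> i _; rewrite -expr2 sqr_ge0.
move=> /allP H; apply/eqP/colP => i; rewrite mxE.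
by have := H i (mem_index_enum _); rewrite mulf_eq0 orbb => /eqP.
Qed.

Lemma dotv_trmx (R : realType) m n (A : 'M[R]_(m, n)) u v :
  dotv u (A *m v) = dotv (A^T *m u) v.
Proof. by rewrite /dotv trmx_mul trmxK mulmxA. Qed.

Lemma dotvC (R : realType) n (u v : 'cV[R]_n) : dotv u v = dotv v u.
Proof. by rewrite !dotvE; apply: eq_bigr => i _; rewrite mulrC. Qed.

Lemma dotvDr (R : realType) n (u v w : 'cV[R]_n) :
  dotv u (v + w) = dotv u v + dotv u w.
Proof. by rewrite /dotv mulmxDr mxE. Qed.

Lemma dotvZr (R : realType) n (a : R) (u v : 'cV[R]_n) :
  dotv u (a *: v) = a * dotv u v.
Proof. by rewrite /dotv -scalemxAr mxE. Qed.

Lemma dotvBr (R : realType) n (u v w : 'cV[R]_n) :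
  dotv u (v - w) = dotv u v - dotv u w.
Proof. by rewrite -scaleN1r dotvDr dotvZr mulN1r. Qed.

Lemma dotvDl (R : realType) n (u v w : 'cV[R]_n) :
  dotv (u + v) w = dotv u w + dotv v w.
Proof. by rewrite dotvC dotvDr !(dotvC w). Qed.

Lemma dotvZl (R : realType) n (a : R) (u v : 'cV[R]_n) :
  dotv (a *: u) v = a * dotv u v.
Proof. by rewrite dotvC dotvZr dotvC. Qed.

Lemma dotvBl (R : realType) n (u v w : 'cV[R]_n) :
  dotv (u - v) w = dotv u w - dotv v w.
Proof. by rewrite dotvC dotvBr !(dotvC w). Qed.

Lemma dotv_delta (R : realType) n (i : 'I_n) (u : 'cV[R]_n) :
  dotv (delta_mx i 0) u = u i 0.
Proof.
rewrite dotvE (bigD1 i)//= big1 ?mxE ?eqxx ?mul1r ?addr0// => j /negPf ji.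
by rewrite mxE ji mul0r.
Qed.

Lemma dotv_col (R : realType) m n (M : 'M[R]_(m, n)) (w : 'cV[R]_m) j :
  dotv (col j M) w = (M^T *m w) j 0.
Proof. by rewrite mxE dotvE; apply: eq_bigr => i _; rewrite !mxE. Qed.

Lemma dotv_mul_col (R : realType) m n (M : 'M[R]_(m, n)) (w : 'cV[R]_m)
    (u : 'cV[R]_n) :
  dotv (M *m u) w = \sum_j dotv (col j M) w * u j 0.
Proof.
rewrite dotvC dotv_trmx dotvE; apply: eq_bigr => j _; congr (_ * _).
by rewrite dotv_col.
Qed.

(** Strong convexity of the squared norm: the two sides differ by
    t (1 - t) |x - y|^2. *)
Lemma dotv_combination_le (R : realType) n (t : R) (x y : 'cV[R]_n) :
  0 <= t <= 1 ->
  dotv (t *: x + (1 - t) *: y) (t *: x + (1 - t) *: y)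
    <= t * dotv x x + (1 - t) * dotv y y.
Proof.
move=> /andP[t0 t1]; rewrite -subr_ge0.
have : 0 <= t * (1 - t) * dotv (x - y) (x - y).
  by rewrite !mulr_ge0 ?subr_ge0 ?dotvv_ge0.
congr (0 <= _).
rewrite !(dotvBl, dotvBr) !(dotvDl, dotvDr, dotvZl, dotvZr) (dotvC y x); ring.
Qed.

(** * The principal square root of a positive definite matrix *)

Lemma interpolation_poly (F : fieldType) (f : F -> F) (s : seq F) :
  exists p : {poly F}, forall x, x \in s -> p.[x] = f x.
Proof.
elim: s => [|a s [p Hp]]; first by exists 0.
have [as_|as_] := boolP (a \in s).
  by exists p => x; rewrite inE => /predU1P[->|]; exact: Hp.
pose m := \prod_(y <- s) ('X - y%:P).
have ma : m.[a] != 0 by rewrite -rootE root_prod_XsubC.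
exists (p + ((f a - p.[a]) / m.[a])%:P * m) => x.
rewrite inE hornerD hornerM hornerC => /predU1P[->|xs].
  by rewrite divfK// addrC subrK.
have /rootP -> : root m x by rewrite root_prod_XsubC.
by rewrite mulr0 addr0 Hp.
Qed.

Lemma posdefmx_unit (R : realType) n (A : 'M[R]_n) :
  posdefmx A -> A \in unitmx.
Proof.
move=> [Asym Apos]; rewrite -row_free_unit -kermx_eq0; apply/eqP/row_matrixP => i.
rewrite row0; set u := row i _.
have uA : u *m A = 0 by rewrite /u -row_mul mulmx_ker row0.
apply/eqP/negP => /negP u0.
have /Apos : u^T != 0 by rewrite -(inj_eq trmx_inj) trmxK trmx0.
by rewrite dotv_trmx -trmx_mul uA trmx0 /dotv trmx0 mul0mx mxE ltxx.
Qed.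

Lemma posdefmx_eigenvalue_gt0 (R : realType) n (A : 'M[R]_n) a :
  posdefmx A -> eigenvalue A a -> 0 < a.
Proof.
move=> [Asym Apos] /eigenvalueP[u uA u0].
have uT0 : u^T != 0 by rewrite -(inj_eq trmx_inj) trmxK trmx0.
have := Apos _ uT0.
rewrite dotv_trmx -trmx_mul uA linearZ /=.
rewrite {1}/dotv linearZ /= -scalemxAl mxE -/(dotv _ _).
by rewrite pmulr_lgt0// dotvv_gt0.
Qed.

(** A real symmetric matrix is diagonalisable with real eigenvalues, in the
    form of a statement that stays over the reals: the diagonalisation takes
    place over the complex numbers, but there A is conjugate to the diagonal
    matrix of its real eigenvalues, on which p vanishes. *)
Lemma symmetric_poly_vanish (R : realType) n (A : 'M[R]_n.+1) (p : {poly R}) :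
  A^T = A -> (forall a, eigenvalue A a -> p.[a] = 0) -> horner_mx A p = 0.
Proof.
move=> Asym Hp.
pose toC : {rmorphism R -> R[i]} := real_complex R; pose AC := map_mx toC A.
have ACreal : AC \is a realmx.
  apply/mxOverP => i j; rewrite mxE; apply/complex_realP; by exists (A i j).
have ACsym : AC \is symmetricmx.
  by apply/is_hermitianmxP; rewrite expr0 scale1r map_mx_id// /AC map_trmx Asym.
have /orthomx_spectralP := symmetric_normalmx ACsym ACreal.
have dreal := hermitian_spectral_diag_real (realsym_hermsym ACsym ACreal).
set U := spectralmx AC; set D := spectral_diag AC => ACE.
have Uu : U \is a GRing.unit by exact: spectral_unit.
apply: (map_mx_inj (f := toC)); rewrite map_mx0 map_horner_mx -/AC ACE.
rewrite (horner_mx_uconjC _ _ Uu) horner_mx_diag.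
suff -> : map_mx (horner (map_poly toC p)) D = 0.
  by rewrite (_ : diag_mx 0 = 0) ?mulmx0 ?mul0mx//; apply/matrixP => i j;
    rewrite !mxE mul0rn.
apply/rowP => j; rewrite !mxE.
have /complex_realP[d dE] : D 0 j \is Num.real by exact: (mxOverP dreal).
rewrite dE -/(toC d) horner_map Hp ?rmorph0//.
(* row j of U is an eigenvector of AC for the real eigenvalue d *)
rewrite -(eigenvalue_map toC) -/AC; apply/eigenvalueP; exists (row j U).
  rewrite ACE !mulmxA -row_mul mulmxV// row1.
  rewrite (_ : delta_mx 0 j *m diag_mx D = D 0 j *: delta_mx 0 j) ?dE.
    by rewrite -scalemxAl -rowE.
  apply/rowP => k; rewrite mul_mx_diag !mxE eqxx /= mulrC.
  by case: eqVneq => [->|]; rewrite ?mulr1 ?mulr0.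
apply: contraL Uu => /eqP Uj.
apply/negP => Uu; have := congr1 (fun M => M *m invmx U) Uj.
rewrite -row_mul mulmxV// mul0mx => /rowP /(_ j).
by rewrite !mxE eqxx => /eqP; rewrite oner_eq0.
Qed.

Lemma horner_mx_sym (R : realType) n (A : 'M[R]_n.+1) (p : {poly R}) :
  A^T = A -> (horner_mx A p)^T = horner_mx A p.
Proof.
move=> Asym; elim/poly_ind: p => [|p c IH]; first by rewrite rmorph0 trmx0.
rewrite rmorphD rmorphM /= horner_mx_X horner_mx_C linearD /=.
rewrite trmx_mul tr_scalar_mx.
rewrite IH Asym; congr (_ + _).
by have := comm_horner_mx2 A 'X p; rewrite /GRing.comm horner_mx_X.
Qed.

(** The root is T T, where T = p(A) and the real polynomial p takes the value
    a^(1/4) at each eigenvalue a.  Fourth roots are used because T T is then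
    visibly positive semidefinite, T being symmetric, whereas for p(A) with
    square roots this would again need the spectral decomposition. *)
Lemma sqrtmx_exists (R : realType) n (A : 'M[R]_n) : posdefmx A ->
  exists S, possemidefmx S /\ S *m S = A.
Proof.
case: n A => [A _|n A Apd].
  by exists 0; split; [split=> [|u]; [|rewrite /dotv mxE big_ord0]|];
    rewrite ?[_ *m _]thinmx0 ?[LHS]thinmx0 ?[RHS]thinmx0.
have [s Hs] : exists s : seq R, forall a, eigenvalue A a -> a \in s.
  have [t Ht] := closed_field_poly_normal
    (map_poly (real_complex R) (char_poly A)).
  exists [seq complex.Re z | z <- t] => a.
  rewrite eigenvalue_root_char -(fmorph_root (real_complex R)) Ht.
  rewrite rootZ ?root_prod_XsubC; last first.
    by rewrite lead_coef_eq0 map_poly_eq0 monic_neq0// char_poly_monic.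
  by move=> ta; apply/mapP; exists (real_complex R a).
have [p Hp] := interpolation_poly (fun x => Num.sqrt (Num.sqrt x)) s.
pose T := horner_mx A p; have Tsym : T^T = T by exact: horner_mx_sym Apd.1.
exists (T *m T); split.
  split=> [|u]; first by rewrite trmx_mul Tsym.
  by rewrite -mulmxA dotv_trmx Tsym dotvv_ge0.
have : horner_mx A ((p * p) * (p * p) - 'X) = 0.
  apply: symmetric_poly_vanish => [|a ea]; first exact: Apd.1.
  rewrite hornerD hornerN hornerX !hornerM (Hp _ (Hs _ ea)).
  rewrite -!expr2 !sqr_sqrtr ?sqrtr_ge0 ?subrr//.
  exact/ltW/(posdefmx_eigenvalue_gt0 Apd ea).
rewrite rmorphB !rmorphM /= horner_mx_X => /eqP; rewrite subr_eq0 => /eqP.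
by [].
Qed.

Lemma sqrtmxP (R : realType) n (A : 'M[R]_n) : posdefmx A ->
  possemidefmx (sqrtmx A) /\ sqrtmx A *m sqrtmx A = A.
Proof.
move=> Apd; have [S HS] := sqrtmx_exists Apd.
exact: (@xgetI _ 0 [set S | possemidefmx S /\ S *m S = A] S HS).
Qed.

(** * Positivity of the normal quantiles above one half *)

(** The density is even, so both closed half-lines have the same mass, and
    their common point is negligible. *)
Lemma normal_prob_Ny0 (R : realType) :
  normal_prob (0 : R) 1 `]-oo, 0] = (2^-1)%:E.
Proof.
pose P (A : set R) := normal_prob (0 : R) 1 A.
have sym : P `]-oo, 0]%classic = P `[0, +oo[%classic.
  rewrite /P /normal_prob ge0_integration_by_substitution0; first last.
  - by move=> x; rewrite lee_fin normal_pdf_ge0.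
  - by apply/measurable_EFinP; exact: measurable_normal_pdf.
  apply: eq_integral => x _.
  by rewrite !normal_pdfE ?oner_eq0// /normal_fun !subr0 sqrrN.
have atom : P `[0, +oo[%classic = P `]0, +oo[%classic.
  rewrite /P -(@setU1itv _ _ _ _ false) ?bnd_simp// measureU//=; last first.
    by apply/seteqP; split=> x //= -[->]; rewrite in_itv/= ltxx.
  rewrite [X in (X + _)%E](_ : _ = 0)%E ?add0e//.
  apply: null_set_integral => //=.
  - by apply/measurable_EFinP/measurable_funTS; exact: measurable_normal_pdf.
  - exact: lebesgue_measure_set1.
have : (P `]-oo, 0%R]%classic + P `]-oo, 0%R]%classic = 1)%E.
  rewrite {2}sym atom /P -measureU//=; last first.
    apply/seteqP; split=> x //= -[]; rewrite !in_itv/= andbT.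
    by move=> /le_lt_trans/[apply]; rewrite ltxx.
  rewrite -[RHS](probability_setT (normal_prob 0 1)); congr (normal_prob _ _ _).
  apply/seteqP; split=> x //= _.
  by rewrite !in_itv/= andbT; case: (leP x 0) => ?; [left|right].
have : P `]-oo, 0]%classic \is a fin_num by exact: fin_num_measure.
rewrite -[normal_prob _ _ _]/(P _); move: (P _) => [x| |]//= _ [] xx.
congr _%:E; lra.
Qed.

(** The density is at most its peak m, so the distribution function at x is at
    most 1/2 + m x for x >= 0; the value p is not reached before (p - 1/2) / m. *)
Lemma normal_quantile_gt0 (R : realType) (p : R) :
  2^-1 < p -> (0 < normal_quantile p)%E.
Proof.
move=> p2; pose m := normal_peak (1 : R).
have m0 : 0 < m by rewrite normal_peak_gt0// oner_eq0.
apply: (@lt_le_trans _ _ ((p - 2^-1) / m)%:E).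
  by rewrite lte_fin divr_gt0// subr_gt0.
apply: le_ereal_inf_tmp => _ [x /= px <-]; rewrite lee_fin ler_pdivrMr//.
rewrite leNgt; apply/negP => xp; move: px; apply/negP; rewrite -ltNge.
pose y := Num.max x 0.
apply: (@le_lt_trans _ _ (normal_prob (0 : R) 1 `]-oo, y])).
  apply: le_measure; rewrite ?inE//=; apply: subset_itvl.
  by rewrite bnd_simp le_max lexx.
rewrite (_ : `]-oo, y]%classic = `]-oo, 0] `|` `]0, y]); last first.
  by rewrite -itv_bndbnd_setU// bnd_simp le_max lexx orbT.
rewrite measureU//=; last first.
  apply/seteqP; split=> u //= -[]; rewrite !in_itv/= => u0 /andP[u1 _].
  by move: (lt_le_trans u1 u0); rewrite ltxx.
apply: (@le_lt_trans _ _ ((2^-1)%:E + (m * y)%:E)%E); last first.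
  rewrite -EFinD lte_fin -ltrBrDl mulrC /y maxEle.
  by case: ifP => _ //; rewrite mul0r subr_gt0.
rewrite normal_prob_Ny0 leeD2l//.
apply: (@le_trans _ _ (\int[lebesgue_measure]_(u in `]0%R, y]) m%:E)%E).
  apply: ge0_le_integral => //=.
  - by move=> u _; rewrite lee_fin normal_pdf_ge0.
  - by apply/measurable_EFinP/measurable_funTS; exact: measurable_normal_pdf.
  - by move=> u _; rewrite lee_fin normal_pdf_ub// oner_eq0.
rewrite integral_cst//= lebesgue_measure_itv/= lte_fin EFinM.
case: ifPn => [y0|]; first by rewrite -EFinD subr0.
by rewrite mule0 -leNgt mule_ge0// lee_fin /y ?le_max ?lexx ?orbT// ltW.
Qed.

(** * The probability simplex *)

Lemma simplex_dim_gt0 (R : realType) n (t : 'cV[R]_n) :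
  simplex t -> (0 < n)%N.
Proof.
case: n t => // t [_].
by rewrite big_ord0 => /esym/eqP; rewrite oner_eq0.
Qed.

Lemma simplexD (R : realType) n (x y : 'cV[R]_n) (t : R) : 0 <= t <= 1 ->
  simplex x -> simplex y -> simplex (t *: x + (1 - t) *: y).
Proof.
move=> /andP[t0 t1] [x0 xs] [y0 ys]; split=> [j|].
  by rewrite !mxE addr_ge0 ?mulr_ge0 ?subr_ge0.
under eq_bigr do rewrite !mxE.
by rewrite big_split/= -!mulr_sumr xs ys !mulr1 subrKC.
Qed.

Lemma simplex_delta (R : realType) n (i : 'I_n) :
  simplex (delta_mx i 0 : 'cV[R]_n).
Proof.
split=> [j|]; first by rewrite mxE ler0n.
rewrite (bigD1 i)//= big1 ?mxE ?eqxx ?addr0// => j /negPf ji.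
by rewrite mxE ji.
Qed.

(** Extreme value theorem on the product of two simplices.  The simplex is seen
    as a closed subset of a box of row vectors, whence the transpositions. *)
Lemma simplex_pair_argmax (R : realType) (n : nat)
    (G : 'cV[R]_n -> 'cV[R]_n -> R) :
  @simplex R n !=set0 ->
  continuous (fun x : 'rV[R]_n * 'rV[R]_n => G x.1^T x.2^T) ->
  exists q s, [/\ simplex q, simplex s &
    forall q' s', simplex q' -> simplex s' -> G q' s' <= G q s].
Proof.
move=> [t0 t0s] Gc.
pose K := [set v : 'rV[R]_n | forall i, `[(0 : R), 1]%classic (v ord0 i)]
          `&` [set v : 'rV[R]_n | \sum_j v ord0 j = 1].
have KE (t : 'cV[R]_n) : simplex t <-> K t^T.
  split=> [[tge0 t1]|[/= Hi H1]].
    split=> /= [i|]; last by rewrite -t1; apply: eq_bigr => j _; rewrite mxE.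
    rewrite mxE in_itv/= tge0/= -t1 (bigD1 i)//= lerDl.
    by rewrite sumr_ge0.
  split=> [j|]; first by have := Hi j; rewrite mxE in_itv => /andP[].
  by rewrite -H1; apply: eq_bigr => j _; rewrite mxE.
have cK : compact K.
  apply: compact_closedI.
    apply: (@rV_compact _ _ (fun=> `[(0 : R), 1]%classic)) => _.
    exact: segment_compact.
  apply: (@preimage_closed _ _ (fun v : 'rV[R]_n => \sum_j v ord0 j) [set 1]).
    move=> v _; apply: continuous_big => [|i _]; last exact: coord_continuous.
    exact: add_continuous.
  exact: closed_eq.
have [|[q s] /set_mem[/= Kq Ks] max] := compact_EVT_max _ (compact_setX cK cK)
    (continuous_subspaceT Gc).
  by exists (t0^T, t0^T); split; apply/KE.
exists q^T, s^T; split; [by apply/KE; rewrite trmxK..|] => q' s' /KE Kq' /KE Ks'.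
have := max (q'^T, s'^T); rewrite /= !trmxK; apply.
by apply: mem_set; split.
Qed.

(** * The chance constraint *)

(** Jensen's inequality in the form of a membership, where only the points of
    positive weight need to lie in K.  The induction carries the pair of the
    total weight and the weighted sum, the latter lying in the cone over K. *)
Lemma convex_combination_mem (R : realType) (V : lmodType R) (n : nat)
    (K : set V) (q : 'I_n -> R) (x : 'I_n -> V) :
  (forall a u w, 0 <= a <= 1 -> K u -> K w -> K (a *: u + (1 - a) *: w)) ->
  (forall j, 0 <= q j) -> \sum_j q j = 1 -> (forall j, 0 < q j -> K (x j)) ->
  K (\sum_j q j *: x j).
Proof.
move=> Kconv q0 q1 Kx.
pose P (m : R) (y : V) := m = 0 /\ y = 0 \/ 0 < m /\ K (m^-1 *: y).
have : P (\sum_j q j) (\sum_j q j *: x j).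
  apply: (big_ind2 P) => [|m1 y1 m2 y2 P1 P2|j _]; first by left.
    case: P1 => [[-> ->]|[m1_gt0 K1]]; first by rewrite !add0r.
    case: P2 => [[-> ->]|[m2_gt0 K2]]; first by rewrite !addr0; right.
    have m_gt0 : 0 < m1 + m2 by rewrite addr_gt0.
    right; split=> //; have := Kconv (m1 / (m1 + m2)) _ _ _ K1 K2.
    have -> : 1 - m1 / (m1 + m2) = m2 / (m1 + m2) by field; rewrite gt_eqF.
    have rescale c y : 0 < c ->
        (c / (m1 + m2)) *: (c^-1 *: y) = (m1 + m2)^-1 *: y.
      by move=> c0; rewrite scalerA mulrAC mulfV ?gt_eqF// mul1r.
    rewrite !rescale// -scalerDr; apply.
    rewrite divr_ge0 ?(ltW m1_gt0) ?(ltW m_gt0)//= ler_pdivrMr// mul1r.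
    by rewrite lerDl ltW.
  have [->|qj] := eqVneq (q j) 0; first by rewrite scale0r; left.
  have {}qj : 0 < q j by rewrite lt_neqAle eq_sym qj q0.
  by right; rewrite scalerA mulVf ?gt_eqF// scale1r; split=> //; exact: Kx.
by rewrite q1 => -[[/eqP]|[_]]; rewrite ?oner_eq0 ?invr1 ?scale1r.
Qed.

Lemma concave_le (R : realType) (V : lmodType R) (h : V -> R) (u w : V) (a : R) :
  convex_function (setT : set (convex_lmodType V)) (fun xi => - h xi) ->
  0 <= a -> a <= 1 -> a * h u + (1 - a) * h w <= h (a *: u + (1 - a) *: w).
Proof.
move=> hconc a0 a1; rewrite -lerN2.
have := hconc (Itv01 a0 a1) u w (mem_set I) (mem_set I).
by rewrite [X in _ <= X]convRE /= !mulrN -opprD.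
Qed.

(** Conditioning theta on the unsafe atoms, of total mass m > eps, gives weights
    theta / m <= theta / eps, so their barycentre is in the uncertainty set. *)
Lemma uncertainty_set_chance (R : realType) (n d : nat) (r : 'I_n -> 'cV[R]_d)
    (h : 'cV[R]_d -> R) (eps : R) (Theta : set 'cV[R]_n) (theta : 'cV[R]_n) :
  0 < eps ->
  convex_function (setT : set (convex_lmodType 'cV[R]_d)) (fun xi => - h xi) ->
  Theta theta -> simplex theta ->
  (forall xi, uncertainty_set r eps Theta xi -> h xi <= 0) ->
  1 - eps <= discrete_prob r theta [set xi | h xi <= 0].
Proof.
move=> eps0 hconc Th [theta0 theta1] hXi.
have memE j : (r j \in [set xi | h xi <= 0]) = (h (r j) <= 0).
  by apply/idP/idP; rewrite inE.
rewrite /discrete_prob; under eq_bigl do rewrite memE.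
set safe := \sum_(j | _) _; rewrite leNgt; apply/negP => risky.
pose m := \sum_(j | ~~ (h (r j) <= 0)) theta j 0.
have mE : m = 1 - safe.
  by rewrite -theta1 (bigID (fun j => h (r j) <= 0))/= -/safe addrC addrK.
have eps_m : eps < m by rewrite mE; lra.
have m0 := lt_trans eps0 eps_m.
pose q : 'cV[R]_n := \col_j if h (r j) <= 0 then 0 else theta j 0 / m.
have q0 j : 0 <= q j 0.
  by rewrite mxE; case: ifP => // _; rewrite divr_ge0// ltW.
have q1 : \sum_j q j 0 = 1.
  rewrite (bigID (fun j => h (r j) <= 0))/= big1 ?add0r => [|j hj]; last first.
    by rewrite mxE hj.
  under eq_bigr => j /negPf hj do rewrite mxE hj.
  by rewrite -mulr_suml -/m mulfV ?gt_eqF.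
have : uncertainty_set r eps Theta (\sum_j q j 0 *: r j).
  exists q, theta; split=> // j; rewrite mxE; case: ifP => _.
    by rewrite mulr_ge0// invr_ge0 ltW.
  by rewrite mulrC ler_wpM2r// lef_pV2 ?posrE// ltW.
move=> /hXi; apply/negP; rewrite -ltNge.
apply: (@convex_combination_mem _ _ _ [set xi | 0 < h xi] (fun j => q j 0) r)
   => //= [a u w /andP[a0 a1] hu hw|j].
  have := concave_le u w hconc a0 a1.
  apply: lt_le_trans.
  have [a_gt0|a_le0] := ltP 0 a.
    by rewrite ltr_pwDl ?mulr_gt0// mulr_ge0 ?subr_ge0// ltW.
  have -> : a = 0 by apply/eqP; rewrite eq_le a_le0.
  by rewrite mul0r add0r subr0 mul1r.
by rewrite mxE; case: ifPn; rewrite ?ltxx// -ltNge.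
Qed.

(** * A Lagrange multiplier for one convex constraint *)

(** Each point x with 0 < g x bounds the multiplier below by (f x - p) / g x,
    each point with g x < 0 bounds it above by the same quotient.  The lower
    bounds do not exceed the upper ones, because the segment joining two such
    points contains a feasible one; x0 makes the set of upper bounds nonempty,
    so the least upper bound of the lower bounds (and of 0) is a multiplier. *)
Lemma lagrange_multiplier (R : realType) (V : lmodType R) (D : set V)
    (f g : V -> R) (x0 : V) (p : R) :
  (forall x y t, D x -> D y -> 0 <= t <= 1 ->
     [/\ D (t *: x + (1 - t) *: y),
         t * f x + (1 - t) * f y <= f (t *: x + (1 - t) *: y) &
         g (t *: x + (1 - t) *: y) <= t * g x + (1 - t) * g y]) ->
  D x0 -> g x0 < 0 -> (forall x, D x -> g x <= 0 -> f x <= p) ->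
  exists2 l, 0 <= l & forall x, D x -> f x - l * g x <= p.
Proof.
move=> conv Dx0 gx0 fp.
have sep x y : D x -> 0 < g x -> D y -> g y < 0 ->
    (f x - p) / g x <= (f y - p) / g y.
  move=> Dx gx Dy gy.
  have gxy : 0 < g x - g y by rewrite subr_gt0 (lt_trans gy).
  (* the point of the segment where the interpolated constraint vanishes *)
  pose t := - g y / (g x - g y).
  have tE : 1 - t = g x / (g x - g y) by rewrite /t; field; rewrite gt_eqF.
  have t01 : 0 <= t <= 1.
    by rewrite divr_ge0 ?(ltW gxy) ?oppr_ge0 ?(ltW gy)//= -subr_ge0 tE
       divr_ge0 ?ltW.
  have [Dm fm gm] := conv x y t Dx Dy t01.
  have gm0 : t * g x + (1 - t) * g y = 0.
    by rewrite tE /t; field; rewrite gt_eqF.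
  have : t * f x + (1 - t) * f y <= p.
    by apply: le_trans fm (fp _ Dm _); rewrite (le_trans gm) ?gm0.
  rewrite tE /t; set s := g x - g y in gxy * => fp'.
  have {}fp' : - g y * f x + g x * f y <= p * s.
    by rewrite -ler_pdivrMr//; move: fp'; congr (_ <= _); field; rewrite gt_eqF.
  rewrite ler_pdivrMr// mulrAC ler_ndivlMr//; rewrite /s in fp'; lra.
pose E := [set 0] `|` [set (f x - p) / g x | x in [set x | D x /\ 0 < g x]].
have ubE y : D y -> g y < 0 -> ubound E ((f y - p) / g y).
  move=> Dy gy _ [->|[x [Dx gx] <-]]; last exact: sep.
  by rewrite -mulrNN -invrN divr_ge0// ?oppr_ge0 ?subr_le0 ?(ltW gy)// fp// ltW.
have hsE : has_sup E.
  by split; [exists 0; left | exists ((f x0 - p) / g x0); exact: ubE].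
exists (sup E) => [|x Dx]; first by apply: ub_le_sup; [case: hsE | left].
rewrite lerBlDl -lerBlDr; have [gx|gx|gx] := ltgtP (g x) 0.
- rewrite -ler_ndivlMr//; apply: sup_le_ub; [by case: hsE | exact: ubE].
- rewrite -ler_pdivrMr//; apply: ub_le_sup; [by case: hsE | by right; exists x].
- by rewrite gx mulr0 subr_le0 fp// gx.
Qed.

(** The first-order condition at a maximum, for the variation t a - t^2 b of a
    quadratic function along a segment: divide by t and let t vanish. *)
Lemma quadratic_le_slope (R : realType) (a b : R) :
  (forall t, 0 < t <= 1 -> t * a <= t ^+ 2 * b) -> a <= 0.
Proof.
move=> H; rewrite leNgt; apply/negP => a0.
have b0 : 0 < b.
  have := H 1; rewrite ltr01 lexx expr1n !mul1r => /(_ isT).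
  exact: lt_le_trans.
have ab : 0 < a + b by rewrite addr_gt0.
(* t = 1 gives a <= b, so any t below a / b <= 1 is a contradiction *)
have t01 : 0 < a / (a + b) <= 1.
  by rewrite divr_gt0//= ler_pdivrMr// mul1r lerDl ltW.
have := H _ t01; rewrite expr2 -mulrA ler_pM2l; last by case/andP: t01.
rewrite mulrAC ler_pdivlMr//; nra.
Qed.

(** * The quadratic term of the dual objective *)

Section quadratic_penalty.
Context {R : realType} {n : nat}.
Implicit Types (t u : 'I_n -> R) (l : R).

(** Fenchel's inequality t u - l u^2 <= t^2 / (4 l), summed over the
    coordinates; at l = 0 the right-hand side is +oo unless t = 0. *)
Lemma penalty_ge t u l : 0 <= l ->
  ((\sum_j t j * u j - l * \sum_j u j ^+ 2)%:E
     <= \sum_j (t j ^+ 2)%R%:E / (4 * l)%R%:E)%E.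
Proof.
move=> l0; rewrite mulr_sumr -sumrB -sumEFin; apply: lee_sum => j _.
rewrite inver; case: ifPn => [|l4].
  rewrite mulf_eq0 pnatr_eq0/= => /eqP ->; rewrite mul0r subr0.
  have [->|tj] := eqVneq (t j) 0; first by rewrite mul0r expr0n/= mul0e.
  by rewrite gt0_muley ?leey// lte_fin exprn_even_gt0.
have {}l0 : 0 < l.
  by rewrite lt_neqAle l0 andbT; apply: contra l4 => /eqP <-; rewrite mulr0.
rewrite -EFinM lee_fin ler_pdivlMr ?mulr_gt0// -subr_ge0.
by have := sqr_ge0 (t j - 2 * l * u j); congr (0 <= _); ring.
Qed.

(** The value where Fenchel's inequality is an equality, t = 2 l x; this form
    is valid for l = 0 too. *)
Lemma penalty_scaled (x : 'I_n -> R) l : 0 <= l ->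
  (\sum_j ((2 * l * x j) ^+ 2)%R%:E / (4 * l)%R%:E = (l * \sum_j x j ^+ 2)%:E)%E.
Proof.
move=> l0; rewrite mulr_sumr -sumEFin; apply: eq_bigr => j _.
rewrite inver; case: ifPn => [|l4].
  by rewrite mulf_eq0 pnatr_eq0/= => /eqP ->; rewrite mulr0 !mul0r expr0n/= mul0e.
by rewrite -EFinM; congr _%:E; field; apply: contra l4 => /eqP ->; rewrite mulr0.
Qed.

End quadratic_penalty.

(** * Duality for the support function *)

(** With theta = thetahat + B u, the slack of the constraints C u <= d encoding
    theta in the simplex: the two rows for the total mass are tight, and the
    rows for the signs leave theta itself. *)
Lemma dual_slack (R : realType) n (thetahat theta u : 'cV[R]_n) (B : 'M[R]_n) :
  simplex thetahat -> simplex theta -> B *m u = theta - thetahat ->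
  dual_vector thetahat - dual_matrix B *m u = col_mx 0 theta.
Proof.
move=> [_ hat1] [_ theta1] Bu.
have eBu : const_mx 1 *m B *m u = 0 :> 'cV[R]_1.
  rewrite -mulmxA Bu; apply/colP => i; rewrite !mxE.
  under eq_bigr do rewrite !mxE mul1r.
  by rewrite sumrB hat1 theta1 subrr.
rewrite /dual_vector /dual_matrix !mul_col_mx !mulNmx eBu Bu oppr0.
rewrite hat1 subrr addNr.
rewrite !opp_col_mx !add_col_mx oppr0 opprK !addr0 subrKC; congr col_mx.
by apply/colP => i; rewrite !mxE; case: splitP => j _; rewrite !mxE.
Qed.

Section duality.
Context {R : realType} {n d : nat}.
Variables (r : 'I_n -> 'cV[R]_d) (v : 'cV[R]_d) (eps : R).
Hypothesis eps01 : 0 < eps < 1.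
Variables (thetahat : 'cV[R]_n) (S : 'M[R]_n).
Hypotheses (hat_simplex : simplex thetahat) (Ssym : S^T = S).
Hypothesis Sunit : S \in unitmx.
Let B := invmx S.

Lemma dotv_combination (q : 'cV[R]_n) :
  dotv v (\sum_j q j 0 *: r j) = \sum_j q j 0 * dotv (r j) v.
Proof.
rewrite /dotv mulmx_sumr summxE; apply: eq_bigr => j _.
by rewrite -/(dotv v _) dotvZr dotvC.
Qed.

(** The constraints of the primal point are paired with their multipliers: eta
    with the slack of the simplex constraints, lambda with z^2 - |u|^2, and
    Fenchel's inequality absorbs the remaining linear term in u. *)
Lemma weak_duality (z : \bar R) (q theta w : 'cV[R]_n) beta eta lambda :
  simplex q -> simplex theta ->
  ((norm2 (S *m (theta - thetahat)))%:E <= z)%E ->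
  (forall j, q j 0 <= eps^-1 * theta j 0) ->
  dual_feasible r v beta w eta lambda ->
  ((dotv v (\sum_j q j 0 *: r j))%:E
     <= dual_objective eps z thetahat B beta w eta lambda)%E.
Proof.
move=> [q0 q1] theta_simplex thetaz qtheta [w0 l0 eta0 feas].
case/andP: eps01 => eps0 _.
pose u := S *m (theta - thetahat).
have Bu : B *m u = theta - thetahat by rewrite /u mulKmx.
pose t j := dotv (col j B) w - dotv (col j (dual_matrix B)) eta.
have tu : \sum_j t j * u j 0 = dotv (B *m u) w - dotv (dual_matrix B *m u) eta.
  by rewrite !dotv_mul_col -sumrB; apply: eq_bigr => j _; rewrite mulrBl.
have slack : 0 <= dotv (dual_vector thetahat) eta - dotv (dual_matrix B *m u) eta.
  rewrite -dotvBl (dual_slack hat_simplex theta_simplex Bu) dotvE.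
  rewrite sumr_ge0// => i _.
  rewrite mulr_ge0// mxE; case: splitP => j _; first by rewrite mxE.
  by case: theta_simplex.
have zu : ((dotv u u)%:E <= z ^+ 2)%E.
  rewrite -[X in X%:E]sqr_sqrtr ?dotvv_ge0// EFin_expe.
  have u0 : (0 <= (norm2 u)%:E)%E by rewrite lee_fin sqrtr_ge0.
  by rewrite lee_sqr// (le_trans u0).
have bracket : ((dotv theta w)%:E <= (dotv thetahat w)%:E
    + (dotv (dual_vector thetahat) eta)%:E + z ^+ 2 * lambda%:E
    + \sum_(j < n) ((t j) ^+ 2)%R%:E / (4 * lambda)%R%:E)%E.
  have -> : dotv theta w = dotv thetahat w + dotv (B *m u) w.
    by rewrite Bu dotvBl subrKC.
  apply: (@le_trans _ _ ((dotv thetahat w)%:E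
     + (dotv (dual_vector thetahat) eta)%:E + (dotv u u)%:E * lambda%:E
     + (\sum_j t j * u j 0 - lambda * \sum_j u j 0 ^+ 2)%:E)%E).
    rewrite tu -EFinM -!EFinD lee_fin dotvvE.
    by move: slack; set s := \sum_j _; lra.
  apply: leeD; last exact: penalty_ge.
  by apply: leeD2l; rewrite lee_wpmul2r// lee_fin.
apply: (@le_trans _ _ (beta%:E + (eps^-1)%:E * (dotv theta w)%:E)%E); last first.
  by apply: leeD2l; rewrite lee_wpmul2l// lee_fin invr_ge0 ltW.
rewrite -EFinM -EFinD lee_fin dotv_combination.
apply: (@le_trans _ _ (\sum_j (q j 0 * beta + eps^-1 * (theta j 0 * w j 0)))).
  apply: ler_sum => j _; rewrite mulrA.
  apply: (@le_trans _ _ (q j 0 * beta + q j 0 * w j 0)).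
    by rewrite -mulrDr ler_wpM2l// -lerBlDr.
  by rewrite lerD2l ler_wpM2r.
by rewrite big_split/= -mulr_suml q1 mul1r -mulr_sumr -dotvE.
Qed.

(** When the ball is vacuous, all the mass can be put on an atom r_i for which
    r_i . v is maximal, and multipliers that vanish certify this. *)
Lemma strong_duality_no_ball p : (forall i, dotv (r i) v <= p) ->
  exists beta w eta lambda, dual_feasible r v beta w eta lambda /\
    (dual_objective eps +oo thetahat B beta w eta lambda = p%:E)%E.
Proof.
move=> pmax; exists p, 0, 0, 0; split.
  by split=> // [j|i|j]; rewrite ?mxE ?subr0.
have dotv0 m (x : 'cV[R]_m) : dotv x 0 = 0 by rewrite /dotv mulmx0 mxE.
rewrite /dual_objective !dotv0.
under eq_bigr => j _ do rewrite !dotv0 subrr.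
have := @penalty_scaled R n (fun=> 0) 0 (lexx _).
by rewrite !mulr0 mul0r => ->; rewrite !mule0 !adde0 mule0 adde0.
Qed.

Let c : 'cV[R]_n := \col_j dotv (r j) v.

(** The change of variables theta = mix q s, and the vector S (theta - thetahat)
    measured by the ball constraint. *)
Let mix (q s : 'cV[R]_n) := eps *: q + (1 - eps) *: s.
Let dev (q s : 'cV[R]_n) := S *m (mix q s - thetahat).

Lemma dev_combination t (q q' s s' : 'cV[R]_n) :
  dev (t *: q + (1 - t) *: q') (t *: s + (1 - t) *: s')
    = t *: dev q s + (1 - t) *: dev q' s'.
Proof.
rewrite /dev !scalemxAr -mulmxDr; congr mulmx.
by apply/colP => i; rewrite !mxE; ring.
Qed.

Lemma lagrangian_continuous (l k : R) :
  continuous (fun x : 'rV[R]_n * 'rV[R]_n =>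
    dotv c x.1^T - l * (dotv (dev x.1^T x.2^T) (dev x.1^T x.2^T) - k)).
Proof.
have Csum (F : 'I_n -> 'rV[R]_n * 'rV[R]_n -> R) :
    (forall i, continuous (F i)) -> continuous (fun x => \sum_i F i x).
  by move=> HF; apply: continuous_big => //; exact: add_continuous.
have C1 i : continuous (fun x : 'rV[R]_n * 'rV[R]_n => x.1^T i 0).
  rewrite (_ : (fun x => _) = (fun M : 'rV[R]_n => M 0 i) \o fst); last first.
    by apply/funext => x; rewrite mxE.
  by move=> x; apply: continuous_comp; [exact: cvg_fst|exact: coord_continuous].
have C2 i : continuous (fun x : 'rV[R]_n * 'rV[R]_n => x.2^T i 0).
  rewrite (_ : (fun x => _) = (fun M : 'rV[R]_n => M 0 i) \o snd); last first.
    by apply/funext => x; rewrite mxE.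
  by move=> x; apply: continuous_comp; [exact: cvg_snd|exact: coord_continuous].
have Cdev i : continuous (fun x : 'rV[R]_n * 'rV[R]_n => dev x.1^T x.2^T i 0).
  rewrite (_ : (fun x => _) = fun x : 'rV[R]_n * 'rV[R]_n => \sum_j S i j *
      (eps * x.1^T j 0 + (1 - eps) * x.2^T j 0 - thetahat j 0)); last first.
    by apply/funext => x; rewrite mxE; apply: eq_bigr => j _; rewrite !mxE.
  apply: Csum => j x; apply: cvgMl_tmp; apply: cvgB; last exact: cvg_cst.
  by apply: cvgD; apply: cvgMl_tmp; [exact: C1|exact: C2].
rewrite (_ : (fun x => _) = fun x : 'rV[R]_n * 'rV[R]_n =>
    \sum_i c i 0 * x.1^T i 0 - l *
    (\sum_i dev x.1^T x.2^T i 0 * dev x.1^T x.2^T i 0 - k)); last first.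
  by apply/funext => x; rewrite !dotvE.
move=> x; apply: cvgB.
  by apply: Csum => i {}x; apply: cvgMl_tmp; exact: C1.
apply: cvgMl_tmp; apply: cvgB; last exact: cvg_cst.
by apply: Csum => i {}x; apply: cvgM; exact: Cdev.
Qed.

(** An explicit dual point of value at most p, for every upper bound p of the
    primal values.  Its multipliers come from a maximiser (q, s) of the
    Lagrangian: a is the gradient of the penalised ball constraint, and the
    optimal value over the vertices separates into a part in q and a part in
    s, certified by beta and mu. *)
Lemma strong_duality (z p : R) : 0 < z ->
  (forall q theta, simplex q -> simplex theta ->
     norm2 (S *m (theta - thetahat)) <= z ->
     (forall j, q j 0 <= eps^-1 * theta j 0) ->
     \sum_j q j 0 * dotv (r j) v <= p) ->
  exists beta w eta lambda, dual_feasible r v beta w eta lambda /\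
    (dual_objective eps z%:E thetahat B beta w eta lambda <= p%:E)%E.
Proof.
move=> z0 primal; have /andP[eps0 eps1] := eps01.
have eps01w : 0 <= eps <= 1 by rewrite !ltW.
pose D : set ('cV[R]_n * 'cV[R]_n) := [set x | simplex x.1 /\ simplex x.2].
pose f (x : 'cV[R]_n * 'cV[R]_n) := dotv c x.1.
pose g (x : 'cV[R]_n * 'cV[R]_n) := dotv (dev x.1 x.2) (dev x.1 x.2) - z ^+ 2.
have [|||x Dx gx|l l0 lag] :=
  @lagrange_multiplier _ _ D f g (thetahat, thetahat) p.
- move=> [q s] [q' s'] t [/= qs ss] [/= qs' ss'] t01; split=> /=.
  + by split; exact: simplexD.
  + by rewrite /f /= dotvDr !dotvZr.
  + rewrite /g /= dev_combination.
    by have := dotv_combination_le (dev q s) (dev q' s') t01; lra.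
- by [].
- have mix_hat : eps *: thetahat + (1 - eps) *: thetahat - thetahat = 0.
    by apply/colP => i; rewrite !mxE; ring.
  rewrite /g /= /dev /mix mix_hat.
  by rewrite /dotv !mulmx0 mxE sub0r oppr_lt0 exprn_gt0.
- case: Dx => qs ss; rewrite /f dotvE.
  under eq_bigr do rewrite mxE mulrC.
  apply: (primal _ (mix x.1 x.2)) => //; first exact: simplexD.
    rewrite /norm2 -(ger0_norm (ltW z0)) -sqrtr_sqr ler_sqrt ?sqr_ge0//.
    by rewrite -subr_le0.
  move=> j; rewrite mulrC ler_pdivlMr// mulrC !mxE lerDl.
  rewrite mulr_ge0 ?subr_ge0 ?(ltW eps1)//.
  by case: ss.
have [q [s [qs ss max]]] := @simplex_pair_argmax _ _
  (fun q s => dotv c q - l * (dotv (dev q s) (dev q s) - z ^+ 2))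
  (ex_intro _ thetahat hat_simplex) (@lagrangian_continuous l (z ^+ 2)).
pose y := mix q s - thetahat.
pose a := (2 * l) *: (S *m (S *m y)).
pose val := dotv c q - dotv a (mix q s).
(* the Lagrangian linearised at (q, s) is maximal there as well *)
have slope q' s' : simplex q' -> simplex s' ->
    dotv c q' - dotv a (mix q' s') <= val.
  move=> qs' ss'; rewrite -subr_le0.
  pose h := S *m (mix q' s' - mix q s).
  apply: (@quadratic_le_slope _ _ (l * dotv h h)) => t /andP[t0 t1].
  have t01 : 0 <= t <= 1 by rewrite ltW.
  have := max _ _ (simplexD t01 qs' qs) (simplexD t01 ss' ss).
  rewrite dev_combination -[dev q' s'](_ : dev q s + h = _); last first.
    by rewrite /dev /h -mulmxDr; congr mulmx; apply/colP => i; rewrite !mxE; ring.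
  have -> : dotv a (mix q' s') = dotv a (mix q s) + 2 * l * dotv (dev q s) h.
    rewrite -[mix q' s'](subrKC (mix q s)) dotvDr; congr (_ + _).
    by rewrite /a dotvZl /h [in RHS]dotv_trmx Ssym.
  rewrite /val !(dotvDl, dotvDr, dotvZl, dotvZr) (dotvC h (dev q s)).
  set u := dotv _ _; lra.
pose k0 := Ordinal (simplex_dim_gt0 hat_simplex).
have [k _ kmin] := arg_minP (fun k => a k 0) (erefl true : xpredT k0).
pose mu := - a k 0.
(* the maximum of - a over the vertices of s is mu, attained at k *)
have vertex i : c i 0 - eps * a i 0 + (1 - eps) * mu <= val.
  have := slope _ _ (simplex_delta R i) (simplex_delta R k).
  rewrite dotvDr !dotvZr [dotv c _]dotvC !(dotvC a) !dotv_delta.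
  by rewrite /mu; lra.
pose w : 'cV[R]_n := eps *: (const_mx mu + a).
have wE j : w j 0 = eps * (mu + a j 0) by rewrite 2!mxE [const_mx _ _ _]mxE.
pose eta : 'cV[R]_(1 + 1 + n) := col_mx (col_mx (const_mx (Num.max (eps * mu) 0))
   (const_mx (Num.max (- (eps * mu)) 0))) 0.
(* in the dual problem w, eta and lambda are divided by eps: hence the factors
   eps in all of them *)
exists (val - mu), w, eta, (eps * l); split.
  split=> [j||i|j].
  - by rewrite wE mulr_ge0 ?(ltW eps0)// /mu addrC subr_ge0 kmin.
  - by rewrite mulr_ge0// ltW.
  - rewrite mxE; case: splitP => j _; rewrite mxE// .
    by case: splitP => ? _; rewrite mxE le_max lexx orbT.
  - by have := vertex j; rewrite [c _ _]mxE wE; lra.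
have SySy : dotv a y = 2 * l * dotv (S *m y) (S *m y).
  by rewrite /a dotvZl [in RHS]dotv_trmx Ssym.
have CE : (dual_matrix B)^T *m eta = eps *: (B^T *m const_mx mu).
  rewrite /eta /dual_matrix !tr_col_mx !mul_row_col mulmx0 addr0 linearN/= mulNmx.
  rewrite -mulmxBr trmx_mul -mulmxA scalemxAr; congr mulmx.
  apply/colP => i; rewrite mxE big_ord1 !mxE mul1r !maxEle.
  by case: ifPn; case: ifPn; lra.
have res j : dotv (col j B) w - dotv (col j (dual_matrix B)) eta
    = 2 * (eps * l) * (S *m y) j 0.
  rewrite !dotv_col CE /w -scalemxAr mulmxDr scalerDr [X in X - _]mxE.
  rewrite addrAC subrr add0r trmx_inv Ssym /a -scalemxAr mulKmx//.
  by rewrite scalerA mxE; congr (_ * _); ring.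
have ddE : dotv (dual_vector thetahat) eta = 0.
  have := @dual_slack R n thetahat thetahat 0 B hat_simplex hat_simplex.
  rewrite !mulmx0 !subrr subr0 => /(_ erefl) ->.
  by rewrite /dotv /eta tr_col_mx mul_row_col trmx0 mul0mx mulmx0 addr0 mxE.
have hatw : dotv thetahat w = eps * (mu + dotv thetahat a).
  rewrite /w dotvZr dotvDr; congr (_ * (_ + _)).
  rewrite dotvE; under eq_bigr do rewrite mxE.
  by rewrite -mulr_suml; case: hat_simplex => _ ->; rewrite mul1r.
rewrite /dual_objective ddE hatw; under eq_bigr do rewrite res.
rewrite penalty_scaled ?mulr_ge0 ?(ltW eps0)// -EFin_expe -!EFinM -!EFinD lee_fin.
(* both sides equal c . q + l (z^2 - |S y|^2), the Lagrangian at (q, s) *)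
apply: le_trans (lag (q, s) (conj qs ss)).
rewrite /f /g /= -dotvvE -/y [dev q s]/(S *m y).
have -> : val = dotv c q - dotv a thetahat - dotv a y.
  by rewrite /val -[mix q s](subrKC thetahat) dotvDr opprD addrA.
rewrite SySy (dotvC thetahat a) le_eqVlt; apply/orP; left; apply/eqP.
by field; rewrite gt_eqF.
Qed.

(** By weak duality it is enough to exhibit one dual point whose value is at
    most the supremum; finite z and z = +oo call for different points. *)
Lemma support_function_duality (z : \bar R) : (0 < z)%E ->
  let Theta := [set theta | simplex theta /\
    ((norm2 (S *m (theta - thetahat)))%:E <= z)%E] in
  let Xi := uncertainty_set r eps Theta in
  (exists beta w eta lambda, dual_feasible r v beta w eta lambda /\
     support_function Xi v = dual_objective eps z thetahat B beta w eta lambda) /\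
  (forall beta w eta lambda, dual_feasible r v beta w eta lambda ->
     (support_function Xi v
        <= dual_objective eps z thetahat B beta w eta lambda)%E).
Proof.
move=> z0 Theta Xi; have /andP[eps0 eps1] := eps01.
have weak beta w eta lambda : dual_feasible r v beta w eta lambda ->
    (support_function Xi v
       <= dual_objective eps z thetahat B beta w eta lambda)%E.
  move=> feas; apply: ge_ereal_sup => _ [_ [q [theta [-> qs [ts tz] qt]]] <-].
  exact: (weak_duality qs ts).
split=> //.
suff [beta [w [eta [lambda [feas obj]]]]] : exists beta w eta lambda,
    dual_feasible r v beta w eta lambda /\
    (dual_objective eps z thetahat B beta w eta lambda
       <= support_function Xi v)%E.
  exists beta, w, eta, lambda; split=> //.
  by apply/eqP; rewrite eq_le obj weak.
have supE q theta : simplex q -> Theta theta ->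
    (forall j, q j 0 <= eps^-1 * theta j 0) ->
    ((\sum_j q j 0 * dotv (r j) v)%:E <= support_function Xi v)%E.
  move=> qs Th qt; apply: ereal_sup_ubound; exists (\sum_j q j 0 *: r j).
    by exists q, theta.
  by rewrite dotv_combination.
have scaled theta j : simplex theta -> theta j 0 <= eps^-1 * theta j 0.
  by move=> [theta0 _]; rewrite ler_peMl// invf_ge1// ltW.
pose i0 := Ordinal (simplex_dim_gt0 hat_simplex).
have [i _ imax] := arg_maxP (fun i => dotv (r i) v) (erefl true : xpredT i0).
have [|beta [w [eta [lambda [feas obj]]]]] :=
  @strong_duality_no_ball (dotv (r i) v).
  by move=> j; exact: imax.
move: z0 @Theta @Xi weak supE; case: z => [z| |]// z0 Theta Xi weak supE.
  case supXi: (support_function Xi v) => [p| |].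
  - apply: strong_duality => // q theta qs ts tz qt.
    by rewrite -lee_fin -supXi; apply: (supE _ theta).
  - by exists beta, w, eta, lambda; split; rewrite ?leey.
  - have := supE thetahat thetahat hat_simplex.
    rewrite supXi leeNy_eq => H.
    suff : false by []. apply: H => [|j]; last exact: scaled.
    split=> //; rewrite subrr mulmx0 /norm2 /dotv mulmx0 mxE sqrtr0 lee_fin.
    exact: ltW.
exists beta, w, eta, lambda; split=> //; rewrite obj.
have := supE (delta_mx i 0) (delta_mx i 0) (simplex_delta R i).
rewrite (_ : \sum_j _ = dotv (r i) v); last first.
  have := dotv_delta i (\col_j dotv (r j) v); rewrite mxE => <-.
  by rewrite dotvE; apply: eq_bigr => j _; rewrite [in RHS]mxE [in RHS]mxE mxE.
apply=> [|j]; last exact/scaled/simplex_delta.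
by split; [exact: simplex_delta | exact: leey].
Qed.

End duality.

Theorem theorem8 (R : realType) (n d k N : nat)
    (r : 'I_n -> 'cV[R]_d) (hr : injective r)
    (g : 'cV[R]_d -> 'cV[R]_k -> R)
    (hg : forall x : 'cV[R]_k,
        convex_function (setT : set (convex_lmodType 'cV[R]_d))
                        (fun xi => - g xi x))
    (alpha : R) (halpha : 0 <= alpha < 1)
    (thetac : 'cV[R]_n) (hthetac : simplex thetac)
    (disp : measure_display) (Omega : measurableType disp)
    (P : probability Omega R) (X : 'I_N -> Omega -> 'cV[R]_d)
    (hX : iid_sample P X (discrete_prob r thetac))
    (prior : 'cV[R]_n -> R)
    (hprior : forall theta, simplex theta -> 0 <= prior theta)
    (omega : Omega) (post : 'cV[R]_n -> R)
    (hpost : posterior_density r prior (fun i => X i omega) post)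
    (thetahat : 'cV[R]_n) (hmode : posterior_mode post thetahat)
    (hpos : \forall theta \near thetahat, 0 < post theta)
    (hdiff : twice_differentiable (fun theta => ln (post theta)) thetahat)
    (hinfo : posdefmx (observed_info post thetahat))
    (eps : R) (heps : 0 < eps < 1) :
  let info := observed_info post thetahat in
  let z := normal_quantile (1 - alpha / 2) in
  let Theta := credible_set info thetahat z in
  let Xi := uncertainty_set r eps Theta in
  let B := invmx (sqrtmx info) in
  (forall x : 'cV[R]_k, (forall xi, Xi xi -> g xi x <= 0) ->
     ((1 - eps)%:E <= ereal_inf
        [set (discrete_prob r theta [set xi | g xi x <= 0])%:E
           | theta in Theta])%E) /\
  (forall v : 'cV[R]_d,
     (exists beta w eta lambda, dual_feasible r v beta w eta lambda /\
        support_function Xi v = dual_objective eps z thetahat B beta w eta lambda)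
     /\
     (forall beta w eta lambda, dual_feasible r v beta w eta lambda ->
        (support_function Xi v
           <= dual_objective eps z thetahat B beta w eta lambda)%E)).
Proof.
move=> info z Theta Xi B.
case/andP: halpha => _ alpha1; have /andP[eps0 _] := heps.
have [[Ssym _] SS] := sqrtmxP hinfo.
have Sunit : sqrtmx info \in unitmx.
  by have := posdefmx_unit hinfo; rewrite -{1}SS unitmx_mul => /andP[].
have z0 : (0 < z)%E by apply: normal_quantile_gt0; lra.
split=> [x gXi|v]; last first.
  exact: (support_function_duality r v heps hmode.1 Ssym Sunit z0).
apply: le_ereal_inf_tmp => _ [theta Th <-]; rewrite lee_fin.
apply: (uncertainty_set_chance eps0 (hg x) Th) => //.
by case: Th.
Qed.
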